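(* Let $\mathcal{M}$ be a real antisymmetric $n\times n$ matrix. If $\mathbf{c}(t,\epsilon)=e^{\epsilon\mathcal{M}}\mathbf{C}_0(t)$ is a solution of Curve Shortening in $\mathbb{R}^n$, then for suitably chosen $T\in\mathbb{R}$ the family of curves $\tilde{\mathbf{c}}(\theta,\epsilon)$ defined by \[ \mathbf{c}(t,\epsilon)=\sqrt{2(T-t)}\;\tilde{\mathbf{c}}\bigl(-\tfrac12\ln(T-t),\epsilon\bigr) \] is an eternal solution of Curve Shortening on the unit sphere $\mathbb{S}^{n-1}$. Moreover, $\tilde{\mathbf{c}}$ converges to a cover of some great circle on $\mathbb{S}^{n-1}$, both for $\theta\to\infty$ and for $\theta\to-\infty$.
   Context: A family of smooth parametrized curves $\mathbf{c}(t,\cdot)$ in $\mathbb{R}^n$ evolves by Curve Shortening if $\mathfrak{p}_{\mathbf{c}_s}(\mathbf{c}_t)=\mathbf{c}_{ss}$, where $s$ is arc length along the curve and $\mathfrak{p}_{\mathbf{a}}(\mathbf{w})=\mathbf{w}-\frac{\langle\mathbf{w},\mathbf{a}\rangle}{\|\mathbf{a}\|^2}\mathbf{a}$; if the parametrization satisfies $\mathbf{c}_t\perp\mathbf{c}_s$ this is $\mathbf{c}_t=\mathbf{c}_{ss}$. For a family of the form $\mathbf{c}(t,\epsilon)=e^{\epsilon\mathcal{M}}\mathbf{C}_0(t)$, where $\epsilon\in\mathbb{R}$ is the curve parameter, the evolution by Curve Shortening is expressed by the differential equation $\mathbf{C}_0'(t)=\mathcal{M}^2\mathbf{C}_0(t)/\|\mathcal{M}\mathbf{C}_0(t)\|^2$.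 Curve Shortening for immersed curves in $\mathbb{S}^{n-1}$ is given by $\tilde{\mathbf{c}}_\theta=\tilde{\mathbf{c}}_{ss}+\tilde{\mathbf{c}}$, with $\theta$ as time variable. An eternal solution is one defined for all $\theta\in\mathbb{R}$. A cover of a great circle is a parametrized curve that wraps around that great circle.
   Formalization: C_0(t) is additionally assumed orthogonal to ker M; if C_0 has a nonzero (constant) component in ker M, e.g. a shrinking horizontal circle at height z_0≠0 in R^3, the solution stops before time T and the rescaled family is not eternal. *)

(* Defs.v *)
From HB Require Import structures.
From mathcomp Require Import all_boot all_order all_algebra.
From mathcomp Require Import all_classical all_reals all_analysis.

Set Implicit Arguments.
Unset Strict Implicit.
Unset Printing Implicit Defensive.

Import Order.TTheory GRing.Theory Num.Theory.
Import numFieldNormedType.Exports.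

Local Open Scope classical_set_scope.
Local Open Scope ring_scope.

Section Euclidean.
Variables (R : realType) (n : nat).
Implicit Types u v w a : 'cV[R]_n.

(* The library's norm on matrices is the sup norm, so the Euclidean structure
   is introduced separately; the two norms define the same topology. *)
Definition dot u v : R := (u^T *m v) 0 0.

Definition enorm u : R := Num.sqrt (dot u u).

Definition proj_orth a w : 'cV[R]_n := w - (dot w a / enorm a ^+ 2) *: a.

Definition expmx (A : 'M[R]_n) : 'M[R]_n :=
  lim (series (fun k : nat => k`!%:R^-1 *: A ^+ k) @ \oo).

(* The curves x |-> e^(xM) C(t). *)
Definition exp_family (M : 'M[R]_n) (C : R -> 'cV[R]_n) (t x : R) : 'cV[R]_n :=
  expmx (x *: M) *m C t.

End Euclidean.

Section Curves.
Variables (R : realType) (n : nat).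
Local Notation V := 'cV[R]_n.
Implicit Types (g f : R -> V) (c : R -> R -> V).

Definition immersed_curve g : Prop :=
  (forall k x, derivable (derive1n k g) x 1) /\ (forall x, derive1 g x != 0).

(* d/ds, for s the arc length along g, of a vector field f along g. *)
Definition dds g f : R -> V := fun x => (enorm (derive1 g x))^-1 *: derive1 f x.

(* A family of curves is written c t x, with t the time and x the curve
   parameter. *)
Definition time_deriv c (t x : R) : V := derive1 (fun t' => c t' x) t.

Definition curve_family (J : set R) c : Prop :=
  forall t, J t ->
    immersed_curve (c t) /\ (forall x, derivable (fun t' => c t' x) t 1).

Definition curve_shortening (J : set R) c : Prop :=
  curve_family J c /\
  forall t x, J t ->
    proj_orth (dds (c t) (c t) x) (time_deriv c t x) =
    dds (c t) (dds (c t) (c t)) x.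

Definition normal_parametrization (J : set R) c : Prop :=
  forall t x, J t -> dot (time_deriv c t x) (dds (c t) (c t) x) = 0.

Definition sphere_curve_shortening (J : set R) c : Prop :=
  [/\ curve_family J c,
      forall t x, J t -> enorm (c t x) = 1 &
      forall t x, J t ->
        time_deriv c t x = dds (c t) (dds (c t) (c t)) x + c t x].

(* a, b is an orthonormal basis of the plane of the great circle, and phi, a
   diffeomorphism of the line, lifts g to the universal cover of the circle. *)
Definition covers_great_circle g : Prop :=
  exists (a b : V) (phi : R -> R),
    [/\ enorm a = 1, enorm b = 1 & dot a b = 0] /\
    [/\ bijective phi,
        forall x, derivable phi x 1,
        forall x, derive1 phi x != 0 &
        forall x, g x = cos (phi x) *: a + sin (phi x) *: b].

(* Convergence of curves: uniform in the curve parameter, together with all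
   derivatives along the curve. *)
Definition curves_cvg (F : set_system R) c g : Prop :=
  forall k : nat,
    {uniform, (fun t => derive1n k (c t)) @ F --> derive1n k g}.

End Curves.

(* Main.v *)
Require Import Defs.
From mathcomp Require Import all_boot all_order all_algebra.
From mathcomp Require Import all_classical all_reals all_analysis.
From mathcomp Require Import ring lra.
From mathcomp.real_closed Require Import complex.

Set Implicit Arguments.
Unset Strict Implicit.
Unset Printing Implicit Defensive.

Import Order.TTheory GRing.Theory Num.Theory.
Import numFieldNormedType.Exports.

Local Open Scope classical_set_scope.
Local Open Scope ring_scope.

(** Write [E x = e^(xM)]. Since [M] is antisymmetric, [E x] is orthogonal and
commutes with [M], so that the curvature vector of the orbit [x |-> E x v] is
[E x (F v)] with [F v = M^2 v / |M v|^2] (lemma [dds_dds_orbit]). A normally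
parametrized family [E x (C t)] therefore evolves by Curve Shortening if and
only if [M C] does not vanish and [C' = F C] ([flow_curve_shortening] and
[curve_shortening_flow]).

Up to a change of time, [C' = F C] is the linear equation [W' = M^2 W]. The
spectral theorem for the symmetric matrix [M^2] writes [C0 t0] as a finite sum
of eigenvectors [u_i] with distinct eigenvalues [mu_i], all negative because
[C0 t0] is orthogonal to [ker M] ([antisymmetric_decomposition]), and
[W s = sum_i e^(mu_i s) u_i] is the solution through [C0 t0]. Since
[(|W|^2)' = - 2 |M W|^2], the function [th = - ln (|W|^2 / 2) / 2] has
derivative the Rayleigh quotient [|M W|^2 / |W|^2], which is bounded below by
[min_i (- mu_i) > 0]; hence [th] is a diffeomorphism of the line ([flow_time]).
In the time [th] the normalized vector [U = W / |W|] solves [U' = F U + U], the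
equation on the sphere, for all times; in the time [t] given by
[|W|^2 = 2 (T - t)] the vector [W] solves [C' = F C] on all of [t < T].

The given solution is this one: its squared norm has derivative [- 2]
([flow_norm]), which fixes [T] and shows that [J] lies in [t < T], and two
solutions that agree at one time agree throughout an interval, by a Gronwall
estimate ([flow_unique]).

As [th] tends to [+oo] (respectively [-oo]), the eigenvector with the largest
(respectively smallest) eigenvalue dominates the sum, and [U] tends to the unit
vector [v = u_i / |u_i|]. The orbit of [v], for which [M^2 v = - l^2 v], is the
great circle [cos (l x) v + sin (l x) M v / l] ([orbit_covers_great_circle]). As
[E x] is orthogonal, the [k]-th derivatives [E x (M^k U)] converge uniformly in
[x] ([orbit_curves_cvg]). *)

(** * Differentiation and limits of matrix-valued functions *)

Section MatrixCalculus.
Variable R : realType.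

Lemma is_derive_mull (l x : R) : is_derive x 1 (fun y => l * y) l.
Proof.
rewrite -[X in is_derive _ _ _ X]mulr1.
exact: (is_deriveZ l (is_derive_id x (1 : R))).
Qed.

Lemma is_derive_mxP m n (A : R -> 'M[R]_(m, n)) (x : R) (dA : 'M[R]_(m, n)) :
  is_derive x 1 A dA <-> forall i j, is_derive x 1 (fun y => A y i j) (dA i j).
Proof.
split=> [[Ax <-] i j | dAx].
  have Axij := (derivable_mxP A x 1).1 Ax i j.
  by apply: DeriveDef => //; rewrite derive_mx// mxE.
have Ax : derivable A x 1 by apply/derivable_mxP => i j; case: (dAx i j).
apply: DeriveDef => //; rewrite derive_mx//; apply/matrixP => i j.
by rewrite mxE; case: (dAx i j).
Qed.

Lemma is_derive_mulmx m n p (A : R -> 'M[R]_(m, n)) (B : R -> 'M[R]_(n, p))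
    (x : R) dA dB :
  is_derive x 1 A dA -> is_derive x 1 B dB ->
  is_derive x 1 (fun y => A y *m B y) (dA *m B x + A x *m dB).
Proof.
move=> /is_derive_mxP dAx /is_derive_mxP dBx; apply/is_derive_mxP => i j.
have -> : (fun y => (A y *m B y) i j) =
    \sum_(k < n) ((fun y => A y i k) * (fun y => B y k j)).
  by apply/funext => y; rewrite mxE fct_sumE; apply: eq_bigr.
have dAB k : is_derive x 1 ((fun y => A y i k) * (fun y => B y k j))
    (A x i k *: dB k j + B x k j *: dA i k).
  exact: is_deriveM.
apply: is_derive_eq; rewrite !mxE -big_split /=; apply: eq_bigr => k _.
by rewrite addrC [B x k j *: _]mulrC.
Qed.

Lemma is_derive_trmx m n (A : R -> 'M[R]_(m, n)) (x : R) dA :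
  is_derive x 1 A dA -> is_derive x 1 (fun y => (A y)^T) dA^T.
Proof.
move=> /is_derive_mxP dAx; apply/is_derive_mxP => i j.
by rewrite mxE; under eq_fun do rewrite mxE.
Qed.

Lemma is_derive_scalemx m n (f : R -> R) (A : R -> 'M[R]_(m, n)) (x df : R) dA :
  is_derive x 1 f df -> is_derive x 1 A dA ->
  is_derive x 1 (fun y => f y *: A y) (df *: A x + f x *: dA).
Proof.
move=> dfx /is_derive_mxP dAx; apply/is_derive_mxP => i j.
under eq_fun do rewrite mxE.
have H : is_derive x 1 (f * (fun y => A y i j)) (f x *: dA i j + A x i j *: df).
  exact: is_deriveM.
by apply: is_derive_eq; rewrite !mxE addrC [A x i j *: _]mulrC.
Qed.

Lemma is_derive_mx_comp m n (A : R -> 'M[R]_(m, n)) (f : R -> R) (x df : R) dA :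
  is_derive (f x) 1 A dA -> is_derive x 1 f df ->
  is_derive x 1 (fun y => A (f y)) (df *: dA).
Proof.
move=> /is_derive_mxP dAx dfx; apply/is_derive_mxP => i j.
rewrite mxE mulrC.
exact: (is_derive1_comp (dAx i j) dfx).
Qed.

Lemma is_derive_sum_mx m n (I : finType) (A : I -> R -> 'M[R]_(m, n)) (x : R)
    (dA : I -> 'M[R]_(m, n)) :
  (forall i, is_derive x 1 (A i) (dA i)) ->
  is_derive x 1 (fun y => \sum_i A i y) (\sum_i dA i).
Proof.
move=> dAx; have -> : (fun y => \sum_i A i y) =
    \sum_(k < #|I|) A (enum_val k).
  by apply/funext => y; rewrite fct_sumE (reindex _ (onW_bij _ (enum_val_bij _))).
rewrite (reindex _ (onW_bij _ (enum_val_bij I))) /=.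
exact: is_derive_sum.
Qed.

Lemma is_derive_dot n (u v : R -> 'cV[R]_n) (x : R) du dv :
  is_derive x 1 u du -> is_derive x 1 v dv ->
  is_derive x 1 (fun y => dot (u y) (v y)) (dot du (v x) + dot (u x) dv).
Proof.
move=> dux dvx; have := is_derive_mulmx (is_derive_trmx dux) dvx.
by move=> /is_derive_mxP/(_ 0 0); rewrite mxE.
Qed.

Lemma cvg_mxP m n (T : Type) (F : set_system T) (FF : Filter F)
    (A : T -> 'M[R]_(m, n)) (L : 'M[R]_(m, n)) :
  (forall i j, A x i j @[x --> F] --> L i j) -> A x @[x --> F] --> L.
Proof.
move=> AL; apply/cvgrPdist_lt => e e0.
near=> x.
rewrite [`|_|]/Num.norm/= mx_normrE; apply/bigmax_ltP; split => // i _.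
rewrite !mxE/=; move: i; near: x; apply: filter_forall => i.
by have /cvgrPdist_lt := AL i.1 i.2; apply.
Unshelve. all: by end_near. Qed.

Lemma cvg_sumr (T I : Type) (F : set_system T) (FF : Filter F)
    (r : seq I) (f : I -> T -> R) (l : I -> R) :
  (forall i, f i x @[x --> F] --> l i) ->
  \sum_(i <- r) f i x @[x --> F] --> \sum_(i <- r) l i.
Proof. by move=> fl; apply: cvg_big => //; exact: add_continuous. Qed.

Lemma cvg_mx_coord m n (T : Type) (F : set_system T) (FF : Filter F)
    (A : T -> 'M[R]_(m, n)) (L : 'M[R]_(m, n)) i j :
  A x @[x --> F] --> L -> A x i j @[x --> F] --> L i j.
Proof. by move=> AL; apply: cvg_comp AL (@coord_continuous _ _ _ i j _). Qed.

Lemma cvg_mulmx m n p (T : Type) (F : set_system T) (FF : Filter F)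
    (A : T -> 'M[R]_(m, n)) (B : T -> 'M[R]_(n, p))
    (LA : 'M[R]_(m, n)) (LB : 'M[R]_(n, p)) :
  A x @[x --> F] --> LA -> B x @[x --> F] --> LB ->
  A x *m B x @[x --> F] --> LA *m LB.
Proof.
move=> ALA BLB; apply: cvg_mxP => i j.
under eq_fun do rewrite mxE; rewrite mxE.
by apply: cvg_sumr => k; apply: cvgM; exact: cvg_mx_coord.
Qed.

Lemma cvg_scalemx m k (T : Type) (F : set_system T) (FF : Filter F)
    (f : T -> R) (A : T -> 'M[R]_(m, k)) (l : R) (L : 'M[R]_(m, k)) :
  f x @[x --> F] --> l -> A x @[x --> F] --> L -> f x *: A x @[x --> F] --> l *: L.
Proof.
move=> fl AL; apply: cvg_mxP => i j.
under eq_fun do rewrite mxE; rewrite mxE.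
by apply: cvgM => //; exact: cvg_mx_coord.
Qed.

Lemma cvg_trmx m n (T : Type) (F : set_system T) (FF : Filter F)
    (A : T -> 'M[R]_(m, n)) (LA : 'M[R]_(m, n)) :
  A x @[x --> F] --> LA -> (A x)^T @[x --> F] --> LA^T.
Proof.
move=> ALA; apply: cvg_mxP => i j.
by under eq_fun do rewrite mxE; rewrite mxE; exact: cvg_mx_coord.
Qed.

Lemma cvg_dot n (T : Type) (F : set_system T) (FF : Filter F)
    (u v : T -> 'cV[R]_n) (Lu Lv : 'cV[R]_n) :
  u x @[x --> F] --> Lu -> v x @[x --> F] --> Lv ->
  dot (u x) (v x) @[x --> F] --> dot Lu Lv.
Proof. by move=> uL vL; apply: cvg_mx_coord; apply: cvg_mulmx => //; exact: cvg_trmx. Qed.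

End MatrixCalculus.

(** * The Euclidean structure *)

Section EuclideanTheory.
Variables (R : realType) (n : nat).
Implicit Types (u v w : 'cV[R]_n) (A : 'M[R]_n).

Lemma dotE u v : dot u v = \sum_i u i 0 * v i 0.
Proof. by rewrite /dot mxE; apply: eq_bigr => i _; rewrite mxE. Qed.

Lemma dotC u v : dot u v = dot v u.
Proof. by rewrite !dotE; apply: eq_bigr => i _; rewrite mulrC. Qed.

Lemma dotDl u v w : dot (u + v) w = dot u w + dot v w.
Proof. by rewrite /dot linearD mulmxDl mxE. Qed.

Lemma dotDr u v w : dot u (v + w) = dot u v + dot u w.
Proof. by rewrite /dot mulmxDr mxE. Qed.

Lemma dotZl c u v : dot (c *: u) v = c * dot u v.
Proof. by rewrite /dot linearZ /= -scalemxAl mxE. Qed.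

Lemma dotZr c u v : dot u (c *: v) = c * dot u v.
Proof. by rewrite /dot -scalemxAr mxE. Qed.

Lemma dotBl u v w : dot (u - v) w = dot u w - dot v w.
Proof. by rewrite dotDl -scaleN1r dotZl mulN1r. Qed.

Lemma dot0l u : dot 0 u = 0.
Proof. by rewrite /dot trmx0 mul0mx mxE. Qed.

Lemma dot_suml (I : finType) (f : I -> 'cV[R]_n) v :
  dot (\sum_i f i) v = \sum_i dot (f i) v.
Proof. by rewrite /dot linear_sum /= mulmx_suml summxE. Qed.

Lemma dot_sumr (I : finType) (f : I -> 'cV[R]_n) v :
  dot v (\sum_i f i) = \sum_i dot v (f i).
Proof. by rewrite dotC dot_suml; apply: eq_bigr => i _; rewrite dotC. Qed.

Lemma dot_mulmx A u v : dot (A *m u) v = dot u (A^T *m v).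
Proof. by rewrite /dot trmx_mul mulmxA. Qed.

Lemma dotvv_ge0 u : 0 <= dot u u.
Proof. by rewrite dotE sumr_ge0 // => i _; rewrite -expr2 sqr_ge0. Qed.

Lemma dotvv_eq0 u : (dot u u == 0) = (u == 0).
Proof.
apply/idP/eqP => [|->]; last by rewrite dot0l.
rewrite dotE psumr_eq0 => [/allP u0|i _]; last by rewrite -expr2 sqr_ge0.
apply/colP => i; rewrite mxE; apply/eqP.
by have := u0 i (mem_index_enum i); rewrite mulf_eq0 orbb.
Qed.

Lemma dotvv_gt0 u : (0 < dot u u) = (u != 0).
Proof. by rewrite lt_neqAle dotvv_ge0 andbT eq_sym dotvv_eq0. Qed.

Lemma sqr_enorm u : enorm u ^+ 2 = dot u u.
Proof. by rewrite sqr_sqrtr // dotvv_ge0. Qed.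

Lemma enorm_eq0 u : (enorm u == 0) = (u == 0).
Proof. by rewrite sqrtr_eq0 le_eqVlt dotvv_eq0 ltNge dotvv_ge0 orbF. Qed.

Lemma enormZ c u : enorm (c *: u) = `|c| * enorm u.
Proof. by rewrite /enorm dotZl dotZr mulrA -expr2 sqrtrM ?sqr_ge0// sqrtr_sqr. Qed.

Lemma coord_le_enorm u i : `|u i 0| <= enorm u.
Proof.
rewrite -sqrtr_sqr ler_wsqrtr // dotE (bigD1 i) //= -expr2 lerDl.
by apply: sumr_ge0 => j _; rewrite -expr2 sqr_ge0.
Qed.

End EuclideanTheory.

(** * The matrix exponential *)

Section MatrixExponential.
Variables (R : realType) (n : nat).
Implicit Types (A M : 'M[R]_n) (x : R).

(** Square matrices of arbitrary, possibly zero, size form a ring in which [*]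
    unfolds to [*m]; this exposes the latter. *)
Lemma mx_exprS M k : M ^+ k.+1 = M *m M ^+ k.
Proof. exact: exprS. Qed.

(** Coefficients dominated by those of an exponential series. The condition is
    stable under formal differentiation, so such a power series can be
    differentiated termwise everywhere. *)
Let exp_dominated (c : R ^nat) :=
  exists B D : R, [/\ 0 <= B, 0 <= D & forall k, `|c k| <= D * (B ^+ k / k`!%:R)].

Let exp_dominated_diffs c : exp_dominated c -> exp_dominated (pseries_diffs c).
Proof.
move=> [B [D [B0 D0 cBD]]]; exists B, (D * B); split => //.
  exact: mulr_ge0.
move=> k; rewrite /pseries_diffs normrM normr_nat.
apply: (le_trans (ler_wpM2l (ler0n _ _) (cBD k.+1))).
rewrite le_eqVlt; apply/orP; left; apply/eqP.
rewrite factS natrM exprS invfM.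
have k0 : k.+1%:R != 0 :> R by rewrite pnatr_eq0.
have f0 : k`!%:R != 0 :> R by rewrite pnatr_eq0 -lt0n fact_gt0.
by field; rewrite f0 nat1r.
Qed.

Let exp_dominated_cvg c x : exp_dominated c -> cvgn (pseries c x).
Proof.
move=> [B [D [B0 D0 cBD]]]; apply: normed_cvg.
pose v k : R := D * ((B * `|x|) ^+ k / k`!%:R).
have v0 k : 0 <= v k.
  by rewrite mulr_ge0 // divr_ge0 // exprn_ge0 // mulr_ge0.
apply: (series_le_cvg _ v0) => [k|k|] /=; first exact: normr_ge0.
  rewrite normrM normrX /v exprMn [X in D * X]mulrAC mulrA.
  by rewrite ler_wpM2r // exprn_ge0.
exact: (is_cvg_seriesZ (is_cvg_series_exp_coeff (B * `|x|))).
Qed.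

Let exp_dominated_derive c x : exp_dominated c ->
  is_derive x 1 (fun x => limn (pseries c x)) (limn (pseries (pseries_diffs c) x)).
Proof.
move=> cdom; apply: (@pseries_snd_diffs _ _ (`|x| + 1)).
- exact: exp_dominated_cvg.
- exact/exp_dominated_cvg/exp_dominated_diffs.
- exact/exp_dominated_cvg/exp_dominated_diffs/exp_dominated_diffs.
- by rewrite [ltRHS]ger0_norm ?ltrDl ?addr_ge0.
Qed.

(** The coefficient of [x ^ k] in the entry [(i, j)] of [e^(xM)]. *)
Definition expmx_coef M i j : R ^nat := fun k => (k`!%:R^-1 *: M ^+ k) i j.

Let expmx_coef_dominated M i j : exp_dominated (expmx_coef M i j).
Proof.
(* The sum of the moduli of all entries dominates every row sum. *)
pose B := \sum_i \sum_j `|M i j|.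
have B0 : 0 <= B by apply: sumr_ge0 => k _; apply: sumr_ge0.
exists B, 1; split => // k.
rewrite /expmx_coef mxE normrM mul1r normfV normr_nat mulrC.
rewrite ler_wpM2r ?invr_ge0 ?ler0n //.
elim: k i j => [|k IH] i j.
  rewrite !expr0 mxE; case: eqP => _ /=; by rewrite ?normr1 ?normr0.
rewrite mx_exprS mxE exprS (le_trans (ler_norm_sum _ _ _)) //.
have : \sum_l `|M i l| * B ^+ k <= B * B ^+ k.
  rewrite -mulr_suml; apply: ler_wpM2r; first exact: exprn_ge0.
  rewrite /B [leRHS](bigD1 i) //= lerDl.
  by apply: sumr_ge0 => l _; apply: sumr_ge0.
apply: le_trans; apply: ler_sum => l _; rewrite normrM ler_wpM2l //.
Qed.

Lemma expmxE M x i j : expmx (x *: M) i j = limn (pseries (expmx_coef M i j) x).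
Proof.
rewrite /expmx; set L := \matrix_(i, j) limn (pseries (expmx_coef M i j) x).
suff -> : lim (series (fun k => k`!%:R^-1 *: (x *: M) ^+ k) @ \oo) = L.
  by rewrite mxE.
apply/cvg_lim => //; apply: cvg_mxP => a b; rewrite mxE.
suff -> : (fun N => series (fun k => k`!%:R^-1 *: (x *: M) ^+ k) N a b) =
    pseries (expmx_coef M a b) x.
  exact/exp_dominated_cvg/expmx_coef_dominated.
apply/funext => N; rewrite /pseries /series /= summxE; apply: eq_bigr => k _.
have -> : (x *: M) ^+ k = x ^+ k *: M ^+ k.
  elim: k => [|k IH]; first by rewrite !expr0 scale1r.
  rewrite !mx_exprS IH exprS.
  by rewrite -scalemxAl -scalemxAr scalerA.
by rewrite /expmx_coef !mxE mulrCA mulrC.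
Qed.

Let expmx_coef_cvg M i j x :
  pseries (expmx_coef M i j) x @ \oo --> expmx (x *: M) i j.
Proof. by rewrite expmxE; exact/exp_dominated_cvg/expmx_coef_dominated. Qed.

Let is_derive_expmx_entry M x i j d :
  (forall k, pseries_diffs (expmx_coef M i j) k = d k) ->
  forall dE, pseries d x @ \oo --> dE ->
  is_derive x 1 (fun y => expmx (y *: M) i j) dE.
Proof.
move=> /funext dE L dL; under eq_fun do rewrite expmxE.
have := exp_dominated_derive x (expmx_coef_dominated M i j).
by rewrite dE; move/cvg_lim : dL => <-.
Qed.

Lemma is_derive_expmx M x :
  is_derive x 1 (fun y => expmx (y *: M)) (M *m expmx (x *: M)).
Proof.
apply/is_derive_mxP => i j.
apply: (@is_derive_expmx_entry _ _ _ _ (fun k => \sum_l M i l * expmx_coef M l j k)).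
  move=> k; rewrite /pseries_diffs /expmx_coef mxE mx_exprS mxE !mulr_sumr.
  apply: eq_bigr => l _; rewrite mxE factS natrM invfM.
  by rewrite -[_^-1 * _ * _]mulrA mulVKf ?pnatr_eq0 // mulrCA.
rewrite mxE; have -> : pseries (fun k => \sum_l M i l * expmx_coef M l j k) x =
    (fun N => \sum_l M i l * pseries (expmx_coef M l j) x N).
  apply/funext => N; rewrite /pseries /series /=.
  under [RHS]eq_bigr do rewrite mulr_sumr.
  rewrite exchange_big /=; apply: eq_bigr => k _; rewrite mulr_suml.
  by apply: eq_bigr => l _; rewrite mulrA.
apply: cvg_sumr => l; apply: cvgMl_tmp; exact: expmx_coef_cvg.
Qed.

Lemma expmx0 M : expmx (0 *: M) = 1%:M.
Proof.
apply/matrixP => i j; rewrite expmxE; apply/cvg_lim => //.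
rewrite -(cvg_shiftS _) /=.
rewrite (_ : (fun N => _) = fun=> (1%:M : 'M[R]_n) i j); first exact: cvg_cst.
apply/funext => N; rewrite /pseries /series /= big_nat_recl //= big1_seq ?addr0.
  by rewrite expr0 mulr1 /expmx_coef mxE fact0 invr1 mul1r expr0.
by move=> k _; rewrite exprS mul0r mulr0.
Qed.

Section Antisymmetric.
Variable M : 'M[R]_n.
Hypothesis M_anti : M^T = - M.

(** For antisymmetric [M] the transpose of [e^(xM)] undoes the flow of
    [f' = M f]: the product below has derivative zero. Orthogonality of
    [e^(xM)], uniqueness for [f' = M f] and commutation with [M] all follow. *)
Let is_derive_flow0 (p : nat) (f : R -> 'M[R]_(n, p)) :
  (forall x, is_derive x 1 f (M *m f x)) ->
  forall x, (expmx (x *: M))^T *m f x = f 0.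
Proof.
move=> df x.
have E0 (y : R) : is_derive y 1 (fun z => (expmx (z *: M))^T *m f z) 0.
  have := is_derive_mulmx (is_derive_trmx (is_derive_expmx M y)) (df y).
  by rewrite trmx_mul M_anti mulmxN mulNmx -mulmxA addNr.
apply/matrixP => i j.
have /(is_derive_0_is_cst x 0) -> : forall y : R,
    is_derive y 1 (fun z => ((expmx (z *: M))^T *m f z) i j) 0.
  by move=> y; have /is_derive_mxP/(_ i j) := E0 y; rewrite mxE.
by rewrite expmx0 trmx1 mul1mx.
Qed.

Lemma trmx_expmxK x : (expmx (x *: M))^T *m expmx (x *: M) = 1%:M.
Proof.
by rewrite (is_derive_flow0 (fun y => is_derive_expmx M y)) expmx0.
Qed.

Lemma expmx_trmxK x : expmx (x *: M) *m (expmx (x *: M))^T = 1%:M.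
Proof. exact/mulmx1C/trmx_expmxK. Qed.

(** A solution of [f' = M f] is the orbit of its initial value. *)
Lemma expmx_flow (p : nat) (f : R -> 'M[R]_(n, p)) :
  (forall x, is_derive x 1 f (M *m f x)) ->
  forall x, f x = expmx (x *: M) *m f 0.
Proof.
by move=> df x; rewrite -(is_derive_flow0 df x) mulmxA expmx_trmxK mul1mx.
Qed.

Lemma expmx_comm x : expmx (x *: M) *m M = M *m expmx (x *: M).
Proof.
have df (y : R) : is_derive y 1 (fun z => M *m expmx (z *: M))
    (M *m (M *m expmx (y *: M))).
  have := is_derive_mulmx (is_derive_cst M y 1) (is_derive_expmx M y).
  by rewrite mul0mx add0r.
by have := expmx_flow df x; rewrite expmx0 mulmx1.
Qed.

Lemma dot_expmx x (u v : 'cV[R]_n) :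
  dot (expmx (x *: M) *m u) (expmx (x *: M) *m v) = dot u v.
Proof. by rewrite dot_mulmx mulmxA trmx_expmxK mul1mx. Qed.

Lemma enorm_expmx x (u : 'cV[R]_n) : enorm (expmx (x *: M) *m u) = enorm u.
Proof. by rewrite /enorm dot_expmx. Qed.

End Antisymmetric.

End MatrixExponential.

(** * Families of orbits evolving by Curve Shortening *)

Section OrbitFamilies.
Variables (R : realType) (n : nat) (M : 'M[R]_n).
Hypothesis M_anti : M^T = - M.
Implicit Types (u v w : 'cV[R]_n) (C : R -> 'cV[R]_n) (J : set R).
Local Notation E x := (expmx (x *: M)).

Lemma dot_anti u v : dot (M *m u) v = - dot u (M *m v).
Proof. by rewrite dot_mulmx M_anti mulNmx -scaleN1r dotZr mulN1r. Qed.

Lemma dot_anti_diag v : dot (M *m v) v = 0.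
Proof.
by apply/eqP; rewrite -[_ == _](mulrn_eq0 _ 2) mulr2n {1}dot_anti dotC addNr.
Qed.

Lemma is_derive_orbit v (x : R) :
  is_derive x 1 (fun y => E y *m v) (E x *m (M *m v)).
Proof.
have := is_derive_mulmx (is_derive_expmx M x) (is_derive_cst v x 1).
by rewrite mulmx0 addr0 -expmx_comm // mulmxA.
Qed.

Lemma derive1_orbit v : derive1 (fun y => E y *m v) = fun x => E x *m (M *m v).
Proof.
by apply/funext => x; rewrite derive1E; have [_] := is_derive_orbit v x.
Qed.

Lemma derive1n_orbit k v :
  derive1n k (fun y => E y *m v) = fun x => E x *m (M ^+ k *m v).
Proof.
elim: k => [|k IH]; first by rewrite derive1n0 expr0 mul1mx.
by rewrite derive1nS IH derive1_orbit mulmxA -mx_exprS.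
Qed.

Lemma immersed_orbit v : M *m v != 0 -> immersed_curve (fun x => E x *m v).
Proof.
move=> Mv0; split=> [k x|x].
  by rewrite derive1n_orbit; case: (is_derive_orbit (M ^+ k *m v) x).
by rewrite derive1_orbit -enorm_eq0 enorm_expmx // enorm_eq0.
Qed.

Lemma immersed_orbit_neq0 v : immersed_curve (fun x => E x *m v) -> M *m v != 0.
Proof.
by case=> _ /(_ 0); rewrite derive1_orbit expmx0 mul1mx.
Qed.

Lemma dds_orbit v w :
  dds (fun x => E x *m v) (fun x => E x *m w) =
  fun x => E x *m ((enorm (M *m v))^-1 *: (M *m w)).
Proof.
apply/funext => x; rewrite /dds !derive1_orbit enorm_expmx //.
by rewrite scalemxAr.
Qed.

(** The curvature vector of an orbit. *)
Lemma dds_dds_orbit v x :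
  dds (fun x => E x *m v) (dds (fun x => E x *m v) (fun x => E x *m v)) x =
  E x *m ((dot (M *m v) (M *m v))^-1 *: (M *m (M *m v))).
Proof.
rewrite !dds_orbit; congr (_ *m _).
by rewrite -scalemxAr scalerA -sqr_enorm -expr2 exprVn.
Qed.

Lemma is_derive_exp_family C (t x : R) dC :
  is_derive t 1 C dC -> is_derive t 1 (fun t' => exp_family M C t' x) (E x *m dC).
Proof.
move=> dCt; have := is_derive_mulmx (is_derive_cst (E x) t 1) dCt.
by rewrite mul0mx add0r.
Qed.

(** The vector field whose flow is Curve Shortening of orbits,
    [v |-> M^2 v / |M v|^2], with value 0 where [M v = 0]. *)
Definition shortening_field v : 'cV[R]_n :=
  (dot (M *m v) (M *m v))^-1 *: (M *m (M *m v)).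

Lemma dot_shortening_field v : dot (shortening_field v) (M *m v) = 0.
Proof. by rewrite dotZl dot_anti_diag mulr0. Qed.

Lemma shortening_fieldZ (a : R) v : a != 0 ->
  shortening_field (a *: v) = a^-1 *: shortening_field v.
Proof.
move=> a0; rewrite /shortening_field -!scalemxAr dotZl dotZr !scalerA !invfM.
by congr (_ *: _); rewrite mulrC !mulrA mulfV // mul1r.
Qed.

Lemma proj_orth_id a w : dot w a = 0 -> proj_orth a w = w.
Proof. by move=> wa; rewrite /proj_orth wa mul0r scale0r subr0. Qed.

Lemma flow_family J C :
  (forall t, J t -> M *m C t != 0 /\ derivable C t 1) ->
  curve_family J (exp_family M C).
Proof.
move=> JC t Jt; have [MC0 /derivableP dC] := JC t Jt; split=> [|x].
  exact: immersed_orbit.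
by case: (is_derive_exp_family x dC).
Qed.

Lemma flow_curve_shortening J C :
  (forall t, J t -> M *m C t != 0 /\ is_derive t 1 C (shortening_field (C t))) ->
  curve_shortening J (exp_family M C) /\ normal_parametrization J (exp_family M C).
Proof.
move=> JC.
have dE t x : J t -> time_deriv (exp_family M C) t x = E x *m shortening_field (C t).
  move=> /JC[_ dC]; rewrite /time_deriv derive1E.
  by case: (is_derive_exp_family x dC).
have normal : normal_parametrization J (exp_family M C).
  move=> t x Jt; rewrite dE // dds_orbit dot_expmx // dotZr.
  by rewrite dot_shortening_field mulr0.
split=> //; split=> [|t x Jt].
  by apply: flow_family => t /JC[? []].
rewrite proj_orth_id; last exact: normal.
by rewrite dE // dds_dds_orbit.
Qed.

Lemma curve_shortening_flow J C :
  curve_shortening J (exp_family M C) -> normal_parametrization J (exp_family M C) ->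
  forall t, J t -> M *m C t != 0 /\ is_derive t 1 C (shortening_field (C t)).
Proof.
move=> [fam cs] normal t Jt; have [imm der] := fam t Jt.
have famE0 : (fun t' => exp_family M C t' 0) = C.
  by apply/funext => t'; rewrite /exp_family expmx0 mul1mx.
split; first exact: immersed_orbit_neq0 imm.
have := der 0; rewrite famE0 => dC; apply: DeriveDef => //.
have := cs t 0 Jt; rewrite proj_orth_id; last exact: normal.
by rewrite dds_dds_orbit expmx0 mul1mx /time_deriv famE0 derive1E.
Qed.

(** On the sphere, [C' = F C + C] for [F] the shortening field is the evolution
    of orbits by Curve Shortening. *)
Lemma flow_sphere_curve_shortening J C :
  (forall t, J t -> [/\ M *m C t != 0, enorm (C t) = 1 &
     is_derive t 1 C (shortening_field (C t) + C t)]) ->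
  sphere_curve_shortening J (exp_family M C).
Proof.
move=> JC; split=> [|t x Jt|t x Jt].
- by apply: flow_family => t /JC[? _ []].
- by have [_ C1 _] := JC t Jt; rewrite enorm_expmx.
have [_ _ dC] := JC t Jt.
rewrite dds_dds_orbit /exp_family -mulmxDr /time_deriv derive1E.
by case: (is_derive_exp_family x dC).
Qed.

(** Orbits converge uniformly, with all their derivatives, as soon as the points
    through which they pass do, because [e^(xM)] is an isometry for every [x]. *)
Lemma orbit_curves_cvg (F : set_system R) (FF : Filter F) C v :
  C t @[t --> F] --> v ->
  curves_cvg F (exp_family M C) (fun x => E x *m v).
Proof.
move=> Cv k P /uniform_nbhs[V [entV VP]].
move: entV; rewrite -entourage_ballE => -[e /= e0 eV].
pose w t := M ^+ k *m (v - C t).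
have w0 : dot (w t) (w t) @[t --> F] --> (0 : R).
  have wL : w t @[t --> F] --> M ^+ k *m (v - v).
    by apply: cvg_mulmx; [exact: cvg_cst|apply: cvgB => //; exact: cvg_cst].
  by have := cvg_dot FF wL wL; rewrite subrr mulmx0 dot0l.
have we : \forall t \near F, dot (w t) (w t) < e ^+ 2.
  exact: (cvgr_lt 0) w0 _ (exprn_gt0 2 e0).
apply: filterS we => t wte; apply: VP => x _; apply: eV => /=.
split=> // i j; rewrite -ball_normE /= !derive1n_orbit.
have -> : (E x *m (M ^+ k *m v)) i j - (E x *m (M ^+ k *m C t)) i j =
    (E x *m w t) i 0.
  by rewrite /w !mulmxBr !mxE (ord1 j).
apply: le_lt_trans (coord_le_enorm _ _) _.
by rewrite enorm_expmx // -(ger0_norm (ltW e0)) -sqrtr_sqr ltr_sqrt ?exprn_gt0.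
Qed.

(** The orbit of a unit eigenvector [v] of [M^2] is a great circle: the curve
    [cos (l x) v + sin (l x) M v / l] solves [f' = M f]. *)
Lemma orbit_covers_great_circle v (l : R) : 0 < l -> enorm v = 1 ->
  M *m (M *m v) = - l ^+ 2 *: v ->
  covers_great_circle (fun x => E x *m v).
Proof.
move=> l0 v1 Mv; have ln0 := lt0r_neq0 l0.
have dotMv : dot (M *m v) (M *m v) = l ^+ 2.
  by rewrite dot_anti Mv dotZr -sqr_enorm v1 expr1n mulr1 opprK.
have dphi (x : R) : is_derive x 1 (fun x => l * x) l := is_derive_mull l x.
exists v, (l^-1 *: (M *m v)), (fun x => l * x); split; split.
- exact: v1.
- by rewrite enormZ /enorm dotMv sqrtr_sqr !gtr0_norm ?invr_gt0 // mulVf.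
- by rewrite dotZr dotC dot_anti_diag mulr0.
- by exists (fun x => l^-1 * x) => x; rewrite mulrA ?mulVf ?mulfV // mul1r.
- by move=> x; case: (dphi x).
- by move=> x; rewrite derive1E; have [_ ->] := dphi x.
move=> x.
pose f (x : R) : 'cV[R]_n := cos (l * x) *: v + sin (l * x) *: (l^-1 *: (M *m v)).
have df (y : R) : is_derive y 1 f (M *m f y).
  have dcos := is_derive_scalemx (is_derive1_comp (is_derive_cos (l * y)) (dphi y))
    (is_derive_cst v y 1).
  have dsin := is_derive_scalemx (is_derive1_comp (is_derive_sin (l * y)) (dphi y))
    (is_derive_cst (l^-1 *: (M *m v)) y 1).
  apply: is_derive_eq (is_deriveD dcos dsin) _.
  rewrite !scaler0 !addr0 /f mulmxDr -!scalemxAr Mv !scalerA addrC.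
  congr (_ *: _ + _ *: _); first by rewrite mulfK.
  by field.
by rewrite -[RHS]/(f x) (expmx_flow M_anti df) /f mulr0 cos0 sin0 scale1r scale0r addr0.
Qed.

End OrbitFamilies.

(** * Spectral decomposition *)

(** The complexification of [S] is Hermitian, hence similar to a real diagonal
    matrix; real matrices that are similar over the complex numbers are similar
    over the reals. *)
Lemma symmetric_diagonalizable (R : rcfType) (n : nat) (S : 'M[R]_n) :
  S^T = S -> exists2 rs : seq R, uniq rs & (\sum_(r <- rs) eigenspace S r :=: 1%:M)%MS.
Proof.
move=> Ssym; apply/diagonalizablePeigen.
pose f : {rmorphism R -> R[i]} := real_complex R.
have real_lift p q (A : 'M[R[i]]_(p, q)) : A \is a mxOver Num.real ->
    exists A0, A = map_mx f A0.
  move=> /mxOverP Areal; exists (map_mx (@complex.Re R) A); apply/matrixP => i j.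
  by rewrite !mxE; exact/esym/RRe_real.
pose Sc := map_mx f S.
have Sc_real : Sc \is a mxOver Num.real.
  by apply/mxOverP => i j; rewrite mxE; apply/complex_realP; exists (S i j).
have Sc_herm : Sc \is hermsymmx.
  apply: realsym_hermsym => //; apply/is_hermitianmxP.
  by rewrite expr0 scale1r map_mx_id // /Sc map_trmx Ssym.
have Dreal := hermitian_spectral_diag_real Sc_herm.
have [D0 D0E] := real_lift _ _ _ Dreal.
have Dc_real : diag_mx (spectral_diag Sc) \is a mxOver Num.real.
  rewrite D0E -map_diag_mx; apply/mxOverP => i j; rewrite mxE.
  by apply/complex_realP; eexists.
have Punit := spectral_unit Sc.
have Ssim : simmx_in unitmx Sc (diag_mx (spectral_diag Sc)).
  exists (spectralmx Sc) => //; apply/simmxP => //.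
  have /orthomx_spectralP {2}-> := hermitian_normalmx Sc_herm.
  by rewrite !mulmxA mulmxV // mul1mx.
have [Q] := real_similar Ssim Sc_real Dc_real.
rewrite inE => /andP[Qreal Qunit] /(simmxP Qunit) QS.
have [Q0 Q0E] := real_lift _ _ _ Qreal.
have Q0unit : Q0 \in unitmx by rewrite -(map_unitmx f) -Q0E.
exists Q0 => //; apply/diagonalizable_forPex; exists D0; apply/simmxP => //.
apply: (map_mx_inj (f := f)).
by rewrite !map_mxM map_diag_mx -Q0E -D0E.
Qed.

Section SpectralDecomposition.
Variables (R : realType) (n : nat).
Implicit Types (S M : 'M[R]_n) (u v w : 'cV[R]_n).

Lemma symmetric_eigenvectors_orthogonal S u w (a b : R) : S^T = S ->
  S *m u = a *: u -> S *m w = b *: w -> a != b -> dot u w = 0.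
Proof.
move=> Ssym Su Sw ab; apply/eqP; have : a * dot u w = b * dot u w.
  by rewrite -dotZl -Su dot_mulmx Ssym Sw dotZr.
by move/eqP; rewrite -subr_eq0 -mulrBl mulf_eq0 subr_eq0 (negbTE ab).
Qed.

(** A vector is a sum of nonzero eigenvectors for distinct eigenvalues, indexed
    by the eigenspaces on which its component does not vanish. *)
Lemma symmetric_decomposition S v : S^T = S ->
  exists (I : finType) (mu : I -> R) (u : I -> 'cV[R]_n),
    [/\ injective mu, forall i, u i != 0,
        forall i, S *m u i = mu i *: u i & v = \sum_i u i].
Proof.
move=> Ssym; have [rs rs_uniq] := symmetric_diagonalizable Ssym.
rewrite (big_nth 0) big_mkord => rs1.
have /sub_sumsmxP[w vw] : (v^T <= \sum_(i < size rs) eigenspace S rs`_i)%MS.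
  by rewrite rs1 submx1.
pose x i := (w i *m eigenspace S rs`_i)^T.
pose A := [pred i | x i != 0]; pose J : finType := {i : 'I_(size rs) | i \in A}.
exists J, (fun i : J => rs`_(val (val i))), (fun i : J => x (val i)).
split=> [i j /eqP|[]//|i|].
- by rewrite nth_uniq ?ltn_ord // => /eqP ij; apply/val_inj/val_inj.
- apply: trmx_inj; rewrite trmx_mul Ssym linearZ /= trmxK.
  exact/eigenspaceP/submxMl.
- rewrite -[v]trmxK vw linear_sum /= (bigID A) /= [X in _ + X]big1 => [|i].
    by rewrite addr0 (big_sub A).
  by rewrite negbK => /eqP.
Qed.

(** The eigenvalues of [M^2] are nonpositive, and 0 does not occur for a vector
    orthogonal to [ker M]. *)
Lemma antisymmetric_decomposition M v : M^T = - M ->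
  (forall w, M *m w = 0 -> dot w v = 0) ->
  exists (I : finType) (mu : I -> R) (u : I -> 'cV[R]_n),
    [/\ injective mu, forall i, u i != 0,
        forall i, M *m (M *m u i) = mu i *: u i, forall i, mu i < 0 &
        v = \sum_i u i].
Proof.
move=> Manti vM; have Ssym : (M *m M)^T = M *m M.
  by rewrite trmx_mul Manti mulmxN mulNmx opprK.
have [I [mu [u [mu_inj u0 Su vu]]]] := symmetric_decomposition v Ssym.
exists I, mu, u; split => // i; first by rewrite mulmxA.
have dotMu : dot (M *m u i) (M *m u i) = - mu i * dot (u i) (u i).
  by rewrite dot_anti // mulmxA Su dotZr mulNr.
rewrite ltNge; apply/negP => mui.
have /eqP : dot (M *m u i) (M *m u i) = 0.
  by apply: le_anti; rewrite dotvv_ge0 andbT dotMu mulNr oppr_le0 mulr_ge0 // dotvv_ge0.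
rewrite dotvv_eq0 => /eqP/vM/eqP; rewrite vu dot_sumr (bigD1 i) //= big1 => [|j ji].
  by rewrite addr0 dotvv_eq0 (negbTE (u0 i)).
apply: (symmetric_eigenvectors_orthogonal Ssym (Su i) (Su j)).
by rewrite (inj_eq mu_inj) eq_sym.
Qed.

End SpectralDecomposition.

(** * Real functions: global inverses and exponential decay *)

Section GlobalInverse.
Variable R : realType.

(** A function whose derivative is bounded below by a positive constant is a
    diffeomorphism of the line. *)
Lemma derive_ge_inverse (f df : R -> R) (c : R) : 0 < c ->
  (forall x : R, is_derive x 1 f (df x)) -> (forall x, c <= df x) ->
  exists g : R -> R, [/\ cancel f g, cancel g f,
    forall y : R, is_derive y 1 g (df (g y))^-1,
    g y @[y --> +oo] --> +oo & g y @[y --> -oo] --> -oo].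
Proof.
move=> c0 fdf cdf.
have fcont : continuous f.
  by move=> x; apply/differentiable_continuous/derivable1_diffP; case: (fdf x).
have fgrow x y : x <= y -> c * (y - x) <= f y - f x.
  move=> xy; have [|z _ ->] := MVT_segment xy (fun z _ => fdf z).
    exact: continuous_subspaceT.
  by rewrite ler_wpM2r ?subr_ge0.
have fmono x y : x < y -> f x < f y.
  move=> xy; rewrite -subr_gt0; apply: lt_le_trans (fgrow _ _ (ltW xy)).
  by rewrite mulr_gt0 ?subr_gt0.
have finj : injective f.
  move=> x y fxy; case: (ltgtP x y) => // /fmono; by rewrite fxy ltxx.
have fsurj y : exists x, f x = y.
  (* f grows at least at speed c, so it takes the value y within b of 0. *)
  pose b := `|y - f 0| / c; have b0 : 0 <= b by rewrite divr_ge0 // ltW.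
  have fb : y <= f b.
    rewrite -(lerD2r (- f 0)); apply: le_trans (fgrow _ _ b0).
    by rewrite subr0 mulrC divfK ?gt_eqF // ler_norm.
  have fNb : f (- b) <= y.
    rewrite -lerN2 -(lerD2l (f 0)).
    have Nb0 : - b <= 0 by rewrite oppr_le0.
    apply: le_trans (fgrow _ _ Nb0).
    by rewrite sub0r opprK mulrC divfK ?gt_eqF // distrC ler_norm.
  have bb : - b <= b by rewrite ge0_cp.
  have [|x _ fx] := IVT bb (continuous_subspaceT fcont) (v := y); last by exists x.
  by rewrite ge_min fNb le_max fb orbT.
have [g gK] := choice fsurj.
have fK : cancel f g by move=> x; apply: finj; rewrite gK.
have gmono A y : f A < y -> A < g y.
  move=> fAy; rewrite ltNge; apply/negP; rewrite le_eqVlt => /orP[/eqP gA|/fmono].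
    by move: fAy; rewrite -gA gK ltxx.
  by rewrite gK => /(lt_trans fAy); rewrite ltxx.
have gmono' A y : y < f A -> g y < A.
  move=> fAy; rewrite ltNge; apply/negP; rewrite le_eqVlt => /orP[/eqP gA|/fmono].
    by move: fAy; rewrite gA gK ltxx.
  by rewrite gK => /(lt_trans fAy); rewrite ltxx.
exists g; split => // [y||].
- rewrite -{1}(gK y); apply: is_derive_inverse => //.
  + by near=> x; exact: fK.
  + by near=> x; exact: fcont.
  + by rewrite gt_eqF // (lt_le_trans c0).
- apply/cvgryPgt => A; near=> y; apply: gmono; near: y.
  by apply: nbhs_pinfty_gt; exact: num_real.
- apply/cvgrNyPlt => A; near=> y; apply: gmono'; near: y.
  by apply: nbhs_ninfty_lt; exact: num_real.
Unshelve. all: by end_near. Qed.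

Lemma cvg_expR_pinfty (a : R) : a < 0 -> expR (a * s) @[s --> +oo] --> (0 : R).
Proof.
move=> a0; have Na0 : 0 < - a by rewrite oppr_gt0.
have H : - a * s @[s --> +oo] --> +oo by apply: gt0_cvgMry Na0 cvg_id.
have := cvg_comp _ _ H (@cvgr_expR R).
by under [X in X @ _ --> _]eq_fun do rewrite /= mulNr opprK.
Qed.

Lemma cvg_expR_ninfty (a : R) : 0 < a -> expR (a * s) @[s --> -oo] --> (0 : R).
Proof.
move=> a0; have /cvg_expR_pinfty H : - a < 0 by rewrite oppr_lt0.
have H' : - s @[s --> -oo] --> (+oo : set_system R) by rewrite ninftyN.
have := cvg_comp _ _ H' H.
by under [X in X @ _ --> _]eq_fun do rewrite /= mulrNN.
Qed.

End GlobalInverse.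

(** * The linear flow and its reparametrizations *)

Section Normalization.
Variables (R : realType) (n : nat).
Implicit Types v : 'cV[R]_n.

(** Radial projection to the unit sphere; the zero vector is mapped to itself. *)
Definition normalize (v : 'cV[R]_n) : 'cV[R]_n := (enorm v)^-1 *: v.

Lemma enorm_normalize v : v != 0 -> enorm (normalize v) = 1.
Proof.
move=> v0; rewrite /normalize enormZ ger0_norm ?invr_ge0 ?sqrtr_ge0 //.
by rewrite mulVf // enorm_eq0.
Qed.

Lemma normalizeZ c v : 0 < c -> normalize (c *: v) = normalize v.
Proof.
move=> c0; rewrite /normalize enormZ gtr0_norm // scalerA invfM.
by rewrite mulrAC mulVf ?mul1r // gt_eqF.
Qed.

Lemma cvg_normalize (T : Type) (F : set_system T) (FF : Filter F)
    (A : T -> 'cV[R]_n) (L : 'cV[R]_n) :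
  L != 0 -> A x @[x --> F] --> L -> normalize (A x) @[x --> F] --> normalize L.
Proof.
move=> L0 AL; apply: cvg_scalemx => //.
apply: cvgV; first by rewrite enorm_eq0.
exact: (cvg_comp _ _ (cvg_dot FF AL AL) (@sqrt_continuous R (dot L L))).
Qed.

End Normalization.

(** The data of this section are the components of an initial vector in distinct
    eigenspaces of [M^2]; the index [i0] says that there is at least one. *)
Section LinearFlow.
Variables (R : realType) (n : nat) (M : 'M[R]_n).
Hypothesis M_anti : M^T = - M.
Variables (I : finType) (mu : I -> R) (u : I -> 'cV[R]_n) (i0 : I).
Hypothesis mu_inj : injective mu.
Hypothesis u_neq0 : forall i, u i != 0.
Hypothesis Mu : forall i, M *m (M *m u i) = mu i *: u i.
Hypothesis mu_lt0 : forall i, mu i < 0.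

(** The solution of [W' = M^2 W] with initial value [\sum_i u i]. *)
Definition linear_flow (s : R) : 'cV[R]_n := \sum_i expR (mu i * s) *: u i.
Local Notation W := linear_flow.

Let u_orth i j : i != j -> dot (u i) (u j) = 0.
Proof.
move=> ij; apply: (@symmetric_eigenvectors_orthogonal _ _ (M *m M) _ _ (mu i) (mu j)).
- by rewrite trmx_mul M_anti mulmxN mulNmx opprK.
- by rewrite -mulmxA.
- by rewrite -mulmxA.
- by rewrite (inj_eq mu_inj).
Qed.

Let dot_comb (a b : I -> R) :
  dot (\sum_i a i *: u i) (\sum_i b i *: u i) = \sum_i a i * b i * dot (u i) (u i).
Proof.
rewrite dot_suml; apply: eq_bigr => i _; rewrite dot_sumr (bigD1 i) //= big1.
  by rewrite addr0 dotZl dotZr mulrA.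
by move=> j ji; rewrite dotZl dotZr u_orth ?mulr0 // eq_sym.
Qed.

Let MMW s : M *m (M *m W s) = \sum_i (mu i * expR (mu i * s)) *: u i.
Proof.
rewrite !mulmx_sumr; apply: eq_bigr => i _.
by rewrite -!scalemxAr Mu scalerA mulrC.
Qed.

Lemma is_derive_linear_flow (s : R) : is_derive s 1 W (M *m (M *m W s)).
Proof.
rewrite MMW; apply: is_derive_sum_mx => i.
have dmu := is_derive_mull (mu i) s.
have := is_derive_scalemx (is_derive1_comp (is_derive_expR (mu i * s)) dmu)
  (is_derive_cst (u i) s 1).
by rewrite scaler0 addr0 mulrC.
Qed.

Let Nsum s : dot (W s) (W s) = \sum_i expR (mu i * s) ^+ 2 * dot (u i) (u i).
Proof. by rewrite dot_comb. Qed.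

Let Qsum s : dot (M *m W s) (M *m W s) =
  \sum_i - mu i * (expR (mu i * s) ^+ 2 * dot (u i) (u i)).
Proof.
rewrite dot_anti // MMW dot_comb -sumrN; apply: eq_bigr => i _; by ring.
Qed.

Let weight_gt0 i s : 0 < expR (mu i * s) ^+ 2 * dot (u i) (u i).
Proof. by rewrite mulr_gt0 ?exprn_gt0 ?expR_gt0 ?dotvv_gt0. Qed.

Lemma linear_flow_neq0 s : W s != 0.
Proof.
rewrite -dotvv_gt0 Nsum (bigD1 i0) //= ltr_pwDl // sumr_ge0 // => i _.
exact: ltW.
Qed.

Lemma mul_linear_flow_neq0 s : M *m W s != 0.
Proof.
have pos i : 0 < - mu i * (expR (mu i * s) ^+ 2 * dot (u i) (u i)).
  by rewrite mulr_gt0 // oppr_gt0.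
rewrite -dotvv_gt0 Qsum (bigD1 i0) //= ltr_pwDl // sumr_ge0 // => i _.
exact: ltW.
Qed.

(** The time [- ln (T - t) / 2] of the spherical evolution, as a function of the
    time [s] of the linear flow, when [T - t] is half the squared norm of [W s]. *)
Definition log_time s : R := - (2^-1 * ln (dot (W s) (W s) / 2)).

(** The Rayleigh quotient of [- M^2] along the linear flow. *)
Definition rayleigh s : R := dot (M *m W s) (M *m W s) / dot (W s) (W s).

Let N_gt0 s : 0 < dot (W s) (W s).
Proof. by rewrite dotvv_gt0 linear_flow_neq0. Qed.

Lemma is_derive_log_time (s : R) : is_derive s 1 log_time (rayleigh s).
Proof.
have dW := is_derive_linear_flow s.
have dN : is_derive s 1 (fun s => dot (W s) (W s) / 2) (- dot (M *m W s) (M *m W s)).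
  rewrite -[X in is_derive _ _ _ X](mulfK (_ : 2 != 0 :> R)) //.
  under eq_fun do rewrite mulrC.
  rewrite [X in is_derive _ _ _ X]mulrC; apply: (is_deriveZ 2^-1).
  apply: is_derive_eq (is_derive_dot dW dW) _.
  by rewrite -!dot_anti // [X in X + _]dotC -mulr2n mulr_natr dotC.
rewrite -[X in is_derive _ _ _ X]opprK; apply: is_deriveN.
have N2 : 0 < dot (W s) (W s) / 2 by rewrite divr_gt0.
have -> : - rayleigh s = 2^-1 * ((dot (W s) (W s) / 2)^-1 * - dot (M *m W s) (M *m W s)).
  by rewrite /rayleigh; field; rewrite gt_eqF.
pose N (s : R) : R := dot (W s) (W s) / 2.
exact (is_deriveZ 2^-1 (@is_derive1_comp _ (@ln R) N s _ _ (is_derive1_ln N2) dN)).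
Qed.

(** The smallest of the numbers [- mu i] is a lower bound. *)
Lemma rayleigh_ge : exists2 c, 0 < c & forall s, c <= rayleigh s.
Proof.
pose j := [arg min_(i < i0) (- mu i)]%O.
have jmin i : - mu j <= - mu i by rewrite /j; case: arg_minP => // k _; apply.
exists (- mu j); first by rewrite oppr_gt0.
move=> s; rewrite ler_pdivlMr // Qsum Nsum mulr_sumr; apply: ler_sum => i _.
by rewrite ler_wpM2r // ltW.
Qed.

(** Along [F], the component [i] of the linear flow dominates all others. *)
Let dominant (F : set_system R) i :=
  forall j, j != i -> expR ((mu j - mu i) * s) @[s --> F] --> (0 : R).

Lemma dominant_cvg (F : set_system R) (FF : Filter F) i : dominant F i ->
  normalize (W s) @[s --> F] --> normalize (u i).
Proof.
move=> dom.
have -> : (fun s => normalize (W s)) =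
    (fun s => normalize (\sum_j expR ((mu j - mu i) * s) *: u j)).
  apply/funext => s; rewrite -(@normalizeZ _ _ (expR (- (mu i * s)))) ?expR_gt0 //.
  rewrite /W scaler_sumr; congr normalize; apply: eq_bigr => j _.
  by rewrite scalerA -expRD mulrBl addrC.
apply: cvg_normalize => //.
rewrite [X in _ --> X](_ : _ = \sum_j (j == i)%:R *: u j); last first.
  rewrite (bigD1 i) //= eqxx scale1r big1 ?addr0 // => j /negbTE->.
  by rewrite scale0r.
apply: cvg_mxP => a b; rewrite summxE.
under eq_fun do rewrite summxE.
apply: cvg_sumr => j; under eq_fun do rewrite mxE.
rewrite mxE; apply: cvgMr_tmp.
have [->|ji] := eqVneq j i; last exact: dom.
by under eq_fun do rewrite subrr mul0r expR0; exact: cvg_cst.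
Qed.

Lemma linear_flow_pinfty : exists i,
  normalize (W s) @[s --> +oo] --> normalize (u i).
Proof.
pose j := [arg max_(i > i0) mu i]%O.
exists j; apply: dominant_cvg => k kj; apply: cvg_expR_pinfty.
rewrite subr_lt0 lt_neqAle (inj_eq mu_inj) kj /= /j.
by case: arg_maxP => // l _; apply.
Qed.

Lemma linear_flow_ninfty : exists i,
  normalize (W s) @[s --> -oo] --> normalize (u i).
Proof.
pose j := [arg min_(i < i0) mu i]%O.
exists j; apply: dominant_cvg => k kj; apply: cvg_expR_ninfty.
rewrite subr_gt0 lt_neqAle (inj_eq mu_inj) eq_sym kj /= /j.
by case: arg_minP => // l _; apply.
Qed.

Lemma limit_circle i : covers_great_circle (fun x => expmx (x *: M) *m normalize (u i)).
Proof.
apply: (@orbit_covers_great_circle _ _ _ M_anti _ (Num.sqrt (- mu i))).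
- by rewrite sqrtr_gt0 oppr_gt0.
- exact: enorm_normalize.
rewrite sqr_sqrtr ?oppr_ge0 ?ltW // opprK /normalize -!scalemxAr Mu.
by rewrite !scalerA mulrC.
Qed.

(** The inverse [g] of the logarithmic time; the second property expresses the
    norm of the linear flow in that time. *)
Lemma flow_time : exists g : R -> R, [/\ cancel log_time g,
  forall y, dot (W (g y)) (W (g y)) = 2 * expR (- (2 * y)),
  forall y : R, is_derive y 1 g (rayleigh (g y))^-1,
  g y @[y --> +oo] --> +oo & g y @[y --> -oo] --> -oo].
Proof.
have [c c0 cray] := rayleigh_ge.
have [g [gK Kg dg gy gNy]] := derive_ge_inverse c0 is_derive_log_time cray.
exists g; split => // y; rewrite -{3}(Kg y) /log_time.
rewrite mulrN opprK mulrA mulfV // mul1r lnK ?posrE ?divr_gt0 //.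
by rewrite mulrC divfK.
Qed.

(** In logarithmic time, the normalized flow solves the equation of Curve
    Shortening on the sphere. *)
Lemma is_derive_normalized_flow (g : R -> R) (y : R) :
  (forall y, dot (W (g y)) (W (g y)) = 2 * expR (- (2 * y))) ->
  is_derive y 1 g (rayleigh (g y))^-1 ->
  let U y := normalize (W (g y)) in
  is_derive y 1 U (shortening_field M (U y) + U y).
Proof.
move=> gN dg /=.
(* The factor a = e^y / sqrt 2 normalizes W, as |W|^2 = 2 e^(-2y). *)
pose a (y : R) := expR y / Num.sqrt 2.
have s2 : 0 < Num.sqrt 2 :> R by rewrite sqrtr_gt0.
have a_gt0 z : 0 < a z by rewrite divr_gt0 ?expR_gt0.
have aE z : a z = (enorm (W (g z)))^-1.
  rewrite /enorm gN sqrtrM // (_ : - (2 * z) = - z + - z); last by ring.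
  rewrite expRD -expr2 sqrtr_sqr ger0_norm ?expR_ge0 //.
  by rewrite expRN invfM invrK mulrC.
have UE : (fun y => normalize (W (g y))) = (fun y => a y *: W (g y)).
  by apply/funext => z; rewrite aE.
have da : is_derive y 1 a (a y).
  rewrite /a; under eq_fun do rewrite mulrC; rewrite mulrC.
  exact: (is_deriveZ _ (is_derive_expR y)).
rewrite UE -[normalize _]/((fun y => normalize (W (g y))) y) UE.
have dW := is_derive_mx_comp (is_derive_linear_flow (g y)) dg.
have := is_derive_scalemx da dW; congr is_derive.
rewrite addrC shortening_fieldZ ?gt_eqF //; congr (_ + _).
rewrite /shortening_field !scalerA; congr (_ *: _).
have N1 : a y ^+ 2 * dot (W (g y)) (W (g y)) = 1.
  by rewrite aE exprVn sqr_enorm mulVf // gt_eqF.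
have a0 : a y != 0 by rewrite gt_eqF.
have -> : (a y)^-1 = a y * dot (W (g y)) (W (g y)).
  by apply: (mulfI a0); rewrite mulfV // mulrA -expr2.
by rewrite /rayleigh invf_div mulrA.
Qed.

(** In the time [t] with [|W|^2 = 2 (T - t)], the linear flow is the flow of the
    shortening field. *)
Lemma is_derive_flow_in_time (g : R -> R) (T t : R) : t < T ->
  (forall y, dot (W (g y)) (W (g y)) = 2 * expR (- (2 * y))) ->
  (forall y : R, is_derive y 1 g (rayleigh (g y))^-1) ->
  let C t := W (g (- (2^-1 * ln (T - t)))) in
  dot (C t) (C t) = 2 * (T - t) /\
  is_derive t 1 C (shortening_field M (C t)).
Proof.
move=> tT gN dg /=; have Tt : 0 < T - t by rewrite subr_gt0.
set y := - (2^-1 * ln (T - t)).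
have N2 : dot (W (g y)) (W (g y)) = 2 * (T - t).
  by rewrite gN /y mulrN opprK mulrA mulfV // mul1r lnK.
split => //.
have dT : is_derive t 1 (fun t => T - t) (-1).
  rewrite -[-1]add0r.
  exact: (is_deriveD (is_derive_cst T t 1) (is_deriveN (is_derive_id t 1))).
have dy : is_derive t 1 (fun t => - (2^-1 * ln (T - t))) (2 * (T - t))^-1.
  rewrite (_ : (2 * (T - t))^-1 = - (2^-1 * ((T - t)^-1 * -1))); last first.
    by rewrite mulrN1 mulrN opprK invfM.
  apply: is_deriveN.
  exact (is_deriveZ 2^-1 (@is_derive1_comp _ (@ln R) (fun t => T - t) t _ _
    (is_derive1_ln Tt) dT)).
pose y_ (t : R) : R := - (2^-1 * ln (T - t)).
have dgy := @is_derive1_comp _ g y_ t _ _ (dg y) dy.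
have := @is_derive_mx_comp _ _ _ W (g \o y_) t _ _ (is_derive_linear_flow (g y)) dgy.
congr is_derive.
rewrite /shortening_field -N2 /rayleigh invf_div mulrAC mulfV ?mul1r //.
by rewrite gt_eqF.
Qed.

End LinearFlow.

(** * Uniqueness of the flow of the shortening field *)

Section Gronwall.
Variable R : realType.

(** Gronwall's inequality, forwards and backwards in time. *)
Lemma gronwall_segment (f df : R -> R) (K a b : R) : a <= b ->
  (forall t : R, a <= t <= b -> is_derive t 1 f (df t)) ->
  (forall t, a <= t <= b -> `|df t| <= K * f t) ->
  f b <= f a * expR (K * (b - a)) /\ f a <= f b * expR (K * (b - a)).
Proof.
move=> ab fdf dfK.
have dexp (l t : R) : is_derive t 1 (fun s => expR (l * s)) (l * expR (l * t)).
  have := is_derive1_comp (is_derive_expR (l * t)) (is_derive_mull l t).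
  by rewrite mulrC.
(* Mean value theorem for f e^(lt), to be used with l = -K and l = K. *)
have weighted (l : R) : exists2 t, a <= t <= b &
    f b * expR (l * b) - f a * expR (l * a) =
    expR (l * t) * (df t + l * f t) * (b - a).
  pose g s := f s * expR (l * s).
  have dg t : a <= t <= b -> is_derive t 1 g (expR (l * t) * (df t + l * f t)).
    move=> tab; have := is_deriveM (fdf t tab) (dexp l t).
    by congr is_derive; rewrite /GRing.scale /=; ring.
  have [||t tab gE] := MVT_segment ab (f := g)
    (df := fun t => expR (l * t) * (df t + l * f t)).
  - by move=> t; rewrite in_itv /= => /andP[at_ tb]; apply: dg; rewrite !ltW.
  - apply: derivable_within_continuous => t; rewrite in_itv /= => tab.
    by case: (dg t tab).
  by exists t => //; move: tab; rewrite in_itv.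
split.
  have [t tab] := weighted (- K).
  have : expR (- K * t) * (df t + - K * f t) * (b - a) <= 0.
    rewrite mulr_le0_ge0 ?subr_ge0 // mulr_ge0_le0 ?expR_ge0 //.
    by rewrite mulNr subr_le0 (le_trans (ler_norm _)) // dfK.
  move=> + E; rewrite -E subr_le0 => H.
  rewrite -(ler_pM2r (expR_gt0 (- K * b))).
  by rewrite -mulrA -expRD (_ : K * (b - a) + - K * b = - K * a) //; ring.
have [t tab] := weighted K.
have : 0 <= expR (K * t) * (df t + K * f t) * (b - a).
  rewrite mulr_ge0 ?subr_ge0 // mulr_ge0 ?expR_ge0 //.
  by have := dfK t tab; rewrite ler_norml => /andP[? _]; lra.
move=> + E; rewrite -E subr_ge0 => H.
rewrite -(ler_pM2r (expR_gt0 (K * a))).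
by rewrite -mulrA -expRD (_ : K * (b - a) + K * a = K * b) //; ring.
Qed.

Lemma gronwall_eq0 (J : set R) (f df k : R -> R) (t0 : R) :
  is_interval J -> J t0 -> f t0 = 0 -> (forall t, J t -> 0 <= f t) ->
  (forall t, J t -> is_derive t 1 f (df t)) ->
  (forall t, J t -> `|df t| <= k t * f t) ->
  (forall t, J t -> {for t, continuous k}) ->
  forall t, J t -> f t = 0.
Proof.
move=> Jitv Jt0 ft0 f0 fdf dfk kcont.
have segment a b : J a -> J b -> a <= b -> exists K,
    f b <= f a * expR (K * (b - a)) /\ f a <= f b * expR (K * (b - a)).
  move=> Ja Jb ab; have Jab t : a <= t <= b -> J t by exact: Jitv.
  have [|c _ kc] := @EVT_max _ k a b ab.
    apply: continuous_in_subspaceT => t; rewrite inE /= in_itv /= => /Jab.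
    exact: kcont.
  exists (k c); apply: (@gronwall_segment f df) => // t tab; first exact/fdf/Jab.
  apply: le_trans (dfk _ (Jab _ tab)) _; rewrite ler_wpM2r ?f0 //; first exact: Jab.
  by apply: kc; rewrite in_itv.
move=> t Jt; apply: le_anti; rewrite f0 // andbT.
have [tt0|/ltW tt0] := leP t t0.
  by have [K [_]] := segment t t0 Jt Jt0 tt0; rewrite ft0 mul0r.
by have [K [+ _]] := segment t0 t Jt0 Jt tt0; rewrite ft0 mul0r.
Qed.

End Gronwall.

Section FlowUniqueness.
Variables (R : realType) (n : nat) (M : 'M[R]_n).
Hypothesis M_anti : M^T = - M.

Lemma quadratic_form_le (B : 'M[R]_n) (y : 'cV[R]_n) :
  `|dot y (B *m y)| <= (\sum_i \sum_j `|B i j|) * dot y y.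
Proof.
rewrite dotE mulr_suml; apply: le_trans (ler_norm_sum _ _ _) _.
apply: ler_sum => i _; rewrite mxE mulr_sumr mulr_suml.
apply: le_trans (ler_norm_sum _ _ _) _; apply: ler_sum => j _.
rewrite !normrM mulrCA ler_wpM2l // -sqr_enorm expr2.
by apply: ler_pM => //; exact: coord_le_enorm.
Qed.

(** The squared distance of two solutions satisfies [f' = Y^T B Y] for [Y] their
    difference and a continuous matrix-valued function [B], hence [|f'| <= k f]
    with [k] continuous. *)
Lemma flow_unique (J : set R) (C D : R -> 'cV[R]_n) (t0 : R) :
  is_interval J -> J t0 -> C t0 = D t0 ->
  (forall t, J t -> M *m C t != 0 /\ is_derive t 1 C (shortening_field M (C t))) ->
  (forall t, J t -> M *m D t != 0 /\ is_derive t 1 D (shortening_field M (D t))) ->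
  forall t, J t -> C t = D t.
Proof.
move=> Jitv Jt0 CD0 JC JD.
pose Y t := C t - D t.
pose p t := (dot (M *m C t) (M *m C t))^-1.
pose q t := (dot (M *m D t) (M *m D t))^-1.
pose B t : 'M[R]_n := (2 * p t) *: (M *m M) +
  (2 * (p t * q t)) *: ((M *m (M *m (C t + D t))) *m (M *m (M *m D t))^T).
pose k t := \sum_i \sum_j `|B t i j|.
pose f t := dot (Y t) (Y t).
pose df t := dot (Y t) (B t *m Y t).
have f0 : forall t, J t -> f t = 0.
  apply: (@gronwall_eq0 _ J f df k t0) => //.
  - by rewrite /f /Y CD0 subrr dot0l.
  - by move=> t _; exact: dotvv_ge0.
  - move=> t Jt; have [MC0 dC] := JC t Jt; have [MD0 dD] := JD t Jt.
    have dY : is_derive t 1 Y (shortening_field M (C t) - shortening_field M (D t)).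
      exact: is_deriveB.
    have := is_derive_dot dY dY; congr is_derive.
    rewrite [X in X + _]dotC -mulr2n -mulr_natl /df /B.
    rewrite mulmxDl -!scalemxAl [RHS]dotDr ![in RHS]dotZr.
    have -> : dot (Y t) ((M *m (M *m (C t + D t)) *m (M *m (M *m D t))^T) *m Y t) =
        dot (Y t) (M *m (M *m (C t + D t))) * dot (Y t) (M *m (M *m D t)).
      rewrite -mulmxA [_^T *m _]mx11_scalar -[in X in X%:M]/(dot _ _).
      by rewrite mul_mx_scalar dotZr [dot _ (Y t)]dotC mulrC.
    (* |M D|^2 - |M C|^2 = <Y, M^2 (C + D)>, by antisymmetry. *)
    have pqE : p t - q t = p t * q t * dot (Y t) (M *m (M *m (C t + D t))).
      rewrite -[dot (Y t) _]opprK -dot_anti // /Y mulmxBr mulmxDr.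
      rewrite !dotDr !dotBl [dot (M *m D t) (M *m C t)]dotC.
      rewrite /p /q; field.
      by rewrite !gt_eqF ?dotvv_gt0.
    have -> : shortening_field M (C t) - shortening_field M (D t) =
        p t *: (M *m M *m Y t) + (p t - q t) *: (M *m (M *m D t)).
      rewrite /shortening_field -/(p t) -/(q t) /Y mulmxBr -!mulmxA.
      by rewrite scalerBr scalerBl addrA subrK.
    by rewrite pqE dotDr !dotZr; ring.
  - by move=> t _; exact: quadratic_form_le.
  - move=> t Jt; have [MC0 dC] := JC t Jt; have [MD0 dD] := JD t Jt.
    have cC : C s @[s --> t] --> C t.
      by apply/differentiable_continuous/derivable1_diffP; case: dC.
    have cD : D s @[s --> t] --> D t.
      by apply/differentiable_continuous/derivable1_diffP; case: dD.
    have mulM (A : R -> 'cV[R]_n) : A s @[s --> t] --> A t ->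
        M *m A s @[s --> t] --> M *m A t.
      by move=> cA; apply: cvg_mulmx => //; exact: cvg_cst.
    have cp : p s @[s --> t] --> p t.
      by apply: cvgV; [rewrite dotvv_eq0|apply: cvg_dot; exact: mulM].
    have cq : q s @[s --> t] --> q t.
      by apply: cvgV; [rewrite dotvv_eq0|apply: cvg_dot; exact: mulM].
    have cB : B s @[s --> t] --> B t.
      apply: cvgD; apply: cvg_scalemx; try exact: cvg_cst.
      + by apply: cvgMl_tmp.
      + by apply: cvgMl_tmp; exact: cvgM.
      + apply: cvg_mulmx; last first.
          apply: cvg_trmx; apply: (mulM (fun s => M *m D s)); exact: (mulM D).
        apply: (mulM (fun s => M *m (C s + D s))); apply: (mulM (fun s => C s + D s)).
        exact: cvgD.
    apply: cvg_sumr => i; apply: cvg_sumr => j; apply: cvg_norm.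
    exact: cvg_mx_coord.
move=> t Jt; apply/eqP; rewrite -subr_eq0 -dotvv_eq0; apply/eqP; exact: f0.
Qed.

End FlowUniqueness.

(** The squared norm of a solution decreases at the constant rate 2, so it determines
    the time at which the solution shrinks to a point. *)
Lemma flow_norm (R : realType) (n : nat) (M : 'M[R]_n) (J : set R)
    (C : R -> 'cV[R]_n) (t0 : R) :
  M^T = - M -> is_interval J -> J t0 ->
  (forall t, J t -> M *m C t != 0 /\ is_derive t 1 C (shortening_field M (C t))) ->
  forall t, J t -> dot (C t) (C t) = 2 * (t0 + dot (C t0) (C t0) / 2 - t).
Proof.
move=> M_anti Jitv Jt0 JC.
pose h (t : R) : R := dot (C t) (C t) - 2 * (t0 + dot (C t0) (C t0) / 2 - t).
have dh (t : R) : J t -> is_derive t 1 h 0.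
  move=> /JC[MC0 dC].
  have dN := is_derive_dot dC dC.
  have dlin : is_derive t 1 (fun t => 2 * (t0 + dot (C t0) (C t0) / 2 - t)) (2 * (-1)).
    rewrite -[-1]add0r; exact: (is_deriveZ 2 (is_deriveD
      (is_derive_cst (t0 + dot (C t0) (C t0) / 2) t 1) (is_deriveN (is_derive_id t 1)))).
  have := is_deriveB dN dlin; congr is_derive.
  rewrite [X in X + _ - _]dotC /shortening_field dotZr.
  rewrite -[dot (C t) _]opprK -dot_anti // mulrN mulVf; last by rewrite dotvv_eq0.
  by ring.
(* The Gronwall estimate asks for a nonnegative function, hence the square. *)
have h0 : forall t, J t -> h t ^+ 2 = 0.
  apply: (@gronwall_eq0 _ J (fun t => h t ^+ 2) (fun=> 0) (fun=> 0) t0) => //.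
  - by rewrite /h [X in X - _](_ : _ = 2 * (t0 + dot (C t0) (C t0) / 2 - t0));
      [rewrite subrr expr0n|field].
  - by move=> t _; exact: sqr_ge0.
  - move=> t Jt; have := is_deriveX 2 (dh t Jt); congr is_derive.
    by rewrite scaler0.
  - by move=> t _; rewrite normr0 mul0r.
  - by move=> t _; exact: cst_continuous.
move=> t Jt; apply/eqP; rewrite -subr_eq0 -[_ == 0]sqrf_eq0; apply/eqP; exact: h0.
Qed.

Theorem mainTheorem4 (R : realType) (n : nat) (M : 'M[R]_n)
    (J : set R) (C0 : R -> 'cV[R]_n) :
  M^T = - M ->
  open J -> is_interval J -> J !=set0 ->
  curve_shortening J (exp_family M C0) ->
  normal_parametrization J (exp_family M C0) ->
  (forall t v, J t -> M *m v = 0 -> dot v (C0 t) = 0) ->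
  exists (T : R) (C : R -> 'cV[R]_n) (ct : R -> R -> 'cV[R]_n),
    [/\ J `<=` `]-oo, T[,
        forall t, J t -> C t = C0 t,
        curve_shortening `]-oo, T[ (exp_family M C) &
        normal_parametrization `]-oo, T[ (exp_family M C)] /\
    [/\ forall t x, t < T ->
          exp_family M C t x =
          Num.sqrt (2 * (T - t)) *: ct (- (2^-1 * ln (T - t))) x,
        sphere_curve_shortening [set: R] ct,
        exists g, covers_great_circle g /\ curves_cvg (pinfty_nbhs R) ct g &
        exists g, covers_great_circle g /\ curves_cvg (ninfty_nbhs R) ct g].
Proof.
move=> M_anti J_open J_itv [t0 Jt0] cs normal kerM.
have C0flow := curve_shortening_flow M_anti cs normal.
have MC0 : M *m C0 t0 != 0 by case: (C0flow t0 Jt0).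
have C00 : C0 t0 != 0 by apply: contraNneq MC0 => ->; rewrite mulmx0.
have [I [mu [u [mu_inj u0 Mu mu0 C0u]]]] :=
  antisymmetric_decomposition M_anti (fun w => kerM t0 w Jt0).
have [i0 _] : exists i0 : I, True.
  apply/not_existsP => noI; move/eqP: C00; apply; rewrite C0u big1 // => i _.
  by case: (noI i).
pose W := linear_flow mu u.
have W_neq0 s : W s != 0 := linear_flow_neq0 M_anti i0 mu_inj u0 Mu s.
have MW_neq0 s : M *m W s != 0 := mul_linear_flow_neq0 M_anti i0 mu_inj u0 Mu mu0 s.
have W0 : W 0 = C0 t0.
  by rewrite C0u; apply: eq_bigr => i _; rewrite mulr0 expR0 scale1r.
have [g [gK gN dg gy gNy]] := flow_time M_anti i0 mu_inj u0 Mu mu0.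
(* T is chosen so that |C0 t0|^2 = 2 (T - t0). *)
pose T := t0 + dot (C0 t0) (C0 t0) / 2.
pose C t := W (g (- (2^-1 * ln (T - t)))).
pose U y := normalize (W (g y)).
have Cflow t : t < T -> dot (C t) (C t) = 2 * (T - t) /\
    M *m C t != 0 /\ is_derive t 1 C (shortening_field M (C t)).
  move=> tT.
  have [CN dC] := is_derive_flow_in_time M_anti i0 mu_inj u0 Mu tT gN dg.
  by split=> //; split=> //; exact: MW_neq0.
have JT : J `<=` `]-oo, T[.
  move=> t Jt; rewrite /= in_itv /=.
  have [MCt _] := C0flow t Jt; rewrite -subr_gt0.
  rewrite -(pmulr_rgt0 _ (_ : 0 < 2)) // -(flow_norm M_anti J_itv Jt0 C0flow Jt).
  by rewrite dotvv_gt0; apply: contraNneq MCt => ->; rewrite mulmx0.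
have CC0 t : J t -> C t = C0 t.
  apply: (flow_unique M_anti J_itv Jt0 _ _ C0flow) => [|s /JT].
    rewrite /C -W0; congr W; rewrite -(gK 0); congr g.
    by rewrite /log_time -/W W0 /T addrAC subrr add0r.
  by rewrite /= in_itv /= => /Cflow[].
have [csC normC] : curve_shortening `]-oo, T[ (exp_family M C) /\
    normal_parametrization `]-oo, T[ (exp_family M C).
  apply: flow_curve_shortening => // t.
  by rewrite /= in_itv /= => /Cflow[].
exists T, C, (exp_family M U); split; split => //.
- move=> t x tT; have [CN _] := Cflow t tT.
  rewrite /exp_family -scalemxAr -/(C t) -CN -/(enorm (C t)) scalerA.
  have Ct0 : enorm (C t) != 0.
    by rewrite enorm_eq0; exact: W_neq0.
  by rewrite mulfV // scale1r.
- apply: flow_sphere_curve_shortening => // y _; split.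
  + by rewrite /U -scalemxAr scaler_eq0 invr_eq0 enorm_eq0 negb_or W_neq0 MW_neq0.
  + by rewrite enorm_normalize.
  + exact: is_derive_normalized_flow.
- have [i Wi] := linear_flow_pinfty i0 mu_inj u0.
  exists (fun x => expmx (x *: M) *m normalize (u i)); split; first exact: limit_circle.
  by apply: orbit_curves_cvg => //; exact: (cvg_comp _ _ gy Wi).
- have [i Wi] := linear_flow_ninfty i0 mu_inj u0.
  exists (fun x => expmx (x *: M) *m normalize (u i)); split; first exact: limit_circle.
  by apply: orbit_curves_cvg => //; exact: (cvg_comp _ _ gNy Wi).
Qed.
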